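(* Let $\alpha,\beta,p,q,k>0$ be real numbers with $kp<1$ and $kq>1$. Put $m_p=\frac{1-kp}{q-p}$, $m_q=\frac{kq-1}{q-p}$ (which are positive) and $$\gamma=\frac{\Gamma(m_p)\,\Gamma(m_q)}{\alpha^{k}\,\Gamma(k)\,(q-p)}\left(\frac{\alpha}{\beta}\right)^{m_p}.$$ Then the origin $x=0$ of the scalar system $$\dot{x}=-\left(\alpha|x|^{p}+\beta|x|^{q}\right)^{k}\operatorname{sign}(x),\qquad x(0)=x_0\in\mathbb{R},$$ is fixed-time stable, and its settling-time function $T$ satisfies $\sup_{x_0\in\mathbb{R}}T(x_0)=\gamma$.
   Context: $\Gamma(z)=\int_0^{+\infty}e^{-t}t^{z-1}\,dt$ is the Gamma function. Consider a system $\dot x=f(x)$, $x(0)=x_0$, with $x\in\mathbb{R}^n$, $f$ continuous and $f(0)=0$; write $x(t,x_0)$ for its solution. Lyapunov stability: the origin is Lyapunov stable if for all $\epsilon>0$ there is $\delta=\delta(\epsilon)>0$ such that for all $\|x_0\|<\delta$, any solution $x(t,x_0)$ exists for all $t\ge 0$ and $\|x(t,x_0)\|<\epsilon$ for all $t\ge 0$. Global finite-time stability: the origin is globally finite-time stable if it is Lyapunov stable and for any $x_0\in\mathbb{R}^n$ there exists $0\le T<+\infty$ such that $x(t,x_0)=0$ for all $t\ge T$. The settling-time function is $T(x_0)=\inf\{T : x(t,x_0)=0\ \forall t\ge T\}$. Fixed-time stability: the origin is fixed-time stable if it is globally finite-time stable and there exists $T_{\max}>0$ with $T(x_0)\le T_{\max}$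 for all $x_0\in\mathbb{R}^n$. *)

(* Defs.v *)
From HB Require Import structures.
From mathcomp Require Export all_boot all_order all_algebra.
From mathcomp Require Export all_classical all_reals all_analysis.

Set Implicit Arguments.
Unset Strict Implicit.
Unset Printing Implicit Defensive.

Import Order.TTheory GRing.Theory Num.Theory.
Import numFieldNormedType.Exports.

Local Open Scope classical_set_scope.
Local Open Scope ring_scope.

Definition Gamma (R : realType) (z : R) : R :=
  \int[lebesgue_measure]_(t in `]0, +oo[) (expR (- t) * t `^ (z - 1)).

Section Stability.
Context {R : realType} {V : normedModType R}.
Implicit Types (f : V -> V) (x : R -> V) (a : V) (b : \bar R) (t T : R).

Definition time_domain b : set R := [set t | 0 <= t /\ (t%:E < b)%E].

(* A solution on [0, b), with b = +oo allowed, is given by a function on all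
   of R whose values outside [0, b) are irrelevant: the derivative is taken
   relatively to [0, b), so it is two-sided for 0 < t and one-sided at t = 0. *)
Definition solution f a b x : Prop :=
  [/\ (0 < b)%E, x 0 = a &
      forall t, time_domain b t ->
        (fun s => (s - t)^-1 *: (x s - x t)) @ within (time_domain b) t^'
          --> f (x t)].

Definition maximal_solution f a b x : Prop :=
  solution f a b x /\
  ~ (exists c y, [/\ (b < c)%E, solution f a c y &
                     forall t, time_domain b t -> y t = x t]).

(* "Any solution exists for all t >= 0" is read as: the interval of existence
   of every maximal solution is [0, +oo). *)
Definition lyapunov_stable f : Prop :=
  forall eps : R, 0 < eps -> exists2 delta : R, 0 < delta &
    forall a, `|a| < delta ->
      forall b x, maximal_solution f a b x ->
        b = +oo%E /\ forall t, 0 <= t -> `|x t| < eps.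

Definition vanishes_after f a T : Prop :=
  0 <= T /\
  forall b x, maximal_solution f a b x ->
    b = +oo%E /\ forall t, T <= t -> x t = 0.

(* The existence clause rules out vacuity; for continuous f on R^n it always
   holds, by Peano's theorem. *)
Definition globally_finite_time_stable f : Prop :=
  lyapunov_stable f /\
  forall a, (exists b x, maximal_solution f a b x) /\
            (exists T, vanishes_after f a T).

(* Extended-real valued: +oo when the solutions never settle. *)
Definition settling_time f a : \bar R :=
  ereal_inf [set T%:E | T in [set T | vanishes_after f a T]].

Definition fixed_time_stable f : Prop :=
  globally_finite_time_stable f /\
  exists2 Tmax : R, 0 < Tmax & forall a, (settling_time f a <= Tmax%:E)%E.

End Stability.

(* Main.v *)
Require Import Defs.
From mathcomp Require Import all_boot all_order all_algebra.
From mathcomp Require Import all_classical all_reals all_analysis.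
From mathcomp Require Import measurable_realfun ring lra.
Import Order.TTheory GRing.Theory Num.Theory.
Import numFieldNormedType.Exports.
Local Open Scope classical_set_scope.
Local Open Scope ring_scope.

(** Write [g y = (alpha y^p + beta y^q)^k], so that the system is
    [x' = - g `|x| sign x], and let [F y] be the integral of [1 / g] from
    [0] to [y].  As long as a solution is away from the origin, separation of
    variables gives [F `|x t| = F `|a| - t]; hence the solution issued from [a]
    reaches the origin exactly at time [F `|a|].  The condition [k p < 1] makes
    [1 / g] integrable at [0], the condition [1 < k q] makes it integrable at
    infinity, and therefore the settling times are finite and their supremum
    is the integral of [1 / g] over the whole half-line.

    The dynamical half rests on the following: [g] is nondecreasing, positive and
    continuous on [0 < y], vanishes at [0] and has limit [0] there, and
    [1 / g] is integrable.  Solutions are unique forward in time because the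
    vector field is nonincreasing: the square of the difference of two
    solutions cannot grow ([solution_unique]).  It is then enough to exhibit one
    solution, [trajectory], built from the inverse [arrival] of [F].  Its only
    delicate point is the arrival time, where the derivative of [arrival] must
    be [0] ([arrival_derive]); there the inequality [y <= g y * F y] does the
    work, because [g y] tends to [0].

    The computational half evaluates the integral of [1 / g].  The substitution
    [y = x^(q - p)] turns it into the integral of [y^(m-1) (alpha + beta y)^(-k)]
    with [m = (1 - k p) / (q - p)], a Beta integral.  Writing
    [Gamma k * (alpha + beta y)^(-k)] as a Laplace integral in an auxiliary
    variable and exchanging the two integrations leaves two Gamma integrals
    ([beta_integral]).  Since an infinite integral would make [Gamma] equal to
    [0], the finiteness of the Gamma integral is needed as well
    ([Gamma_ereal_lty]). *)

(** * Monomial substitutions on the positive half-line *)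

Section HalfLine.
Context {R : realType}.
Implicit Types (c s z x : R) (G : R -> R).
Notation mu := (@lebesgue_measure R).

Lemma powR_monomial_derive c s x : 0 < x ->
  is_derive x 1 (fun y => c * y `^ s) (c * s * x `^ (s - 1)).
Proof.
move=> x0; have := is_derive1_powR s x0 => D.
apply: is_derive_eq; rewrite /GRing.scale /=. ring.
Qed.

Lemma is_derive1_continuous (f : R -> R) x l :
  is_derive x 1 f l -> {for x, continuous f}.
Proof.
by move=> [df _]; apply: differentiable_continuous; exact/derivable1_diffP.
Qed.

Lemma powR_continuous s x : 0 < x -> {for x, continuous (fun y => y `^ s)}.
Proof. move=> x0; exact: is_derive1_continuous (is_derive1_powR s x0). Qed.

Lemma powR_monomial_continuous c s x : 0 < x ->
  {for x, continuous (fun y => c * y `^ s)}.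
Proof.
move=> x0; exact: is_derive1_continuous (powR_monomial_derive c s x x0).
Qed.

Lemma exists_nat_between x : 0 < x -> exists n : nat, n.+1%:R^-1 <= x <= n.+1%:R.
Proof.
move=> x0; pose m := Num.truncn x; pose m' := Num.truncn x^-1.
exists (maxn m m'); have le1 : x <= (maxn m m').+1%:R.
  by rewrite (le_trans (ltW (truncnS_gt x)))// ler_nat ltnS leq_maxl.
rewrite le1 andbT invf_ple ?posrE// (le_trans (ltW (truncnS_gt x^-1)))// ler_nat ltnS.
by rewrite leq_maxr.
Qed.

(** The derivative of [c x^s] may blow up at [0] or at infinity, so the change of
    variables is made on the compact intervals from [1 / (n + 1)] to [n + 1],
    which exhaust the half-line together with their images. *)
Lemma ge0_integral_monomial c s G : 0 < c -> 0 < s ->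
  {in `]0, +oo[, continuous G} -> (forall x, 0 < x -> 0 <= G x) ->
  (\int[mu]_(x in `]0%R, +oo[) (G x)%:E =
   \int[mu]_(x in `]0%R, +oo[) (G (c * x `^ s) * (c * s * x `^ (s - 1)))%:E)%E.
Proof.
move=> c0 s0 cG G0.
pose phi := fun y : R => c * y `^ s.
have phigt0 x : 0 < x -> 0 < phi x by move=> x0; rewrite mulr_gt0// powR_gt0.
have dphi x : 0 < x -> is_derive x 1 phi (c * s * x `^ (s - 1))
  by exact: powR_monomial_derive.
have dphiE x : 0 < x -> phi^`()%classic x = c * s * x `^ (s - 1).
  by move=> x0; rewrite derive1E; apply: (@derive_val _ _ _ _ _ _ _ (dphi x x0)).
have cdphi x : 0 < x -> {for x, continuous phi^`()%classic}.
  move=> x0. rewrite /prop_for /continuous_at dphiE//.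
  apply: (@cvg_trans _ ((c * s * y `^ (s - 1)) @[y --> x])).
    apply: near_eq_cvg; near=> y; rewrite dphiE//; near: y.
    exact: lt_nbhsr.
  exact: powR_monomial_continuous.
have phiincr x y : 0 <= x -> x < y -> phi x < phi y.
  move=> x0 xy; rewrite /phi ltr_pM2l// gt0_ltr_powR// nnegrE// ltW//.
  exact: le_lt_trans xy.
have cphi x : 0 < x -> {for x, continuous phi}.
  by move=> x0; exact: powR_monomial_continuous.
pose l (n : nat) : R := n.+1%:R^-1; pose u (n : nat) : R := n.+1%:R.
have l0 n : 0 < l n by rewrite /l.
have u0 n : 0 < u n by rewrite /u.
have sub n : (\int[mu]_(x in `[phi (l n), phi (u n)]) (G x)%:E =
  \int[mu]_(x in `[l n, u n]) (((G \o phi) * phi^`()%classic) x)%:E)%E.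
  have n1 : l n <= u n :> R.
    by rewrite (@le_trans _ _ 1)// /l /u ?invf_le1// ler1n.
  have n0 := l0 n.
  apply: integration_by_substitution_increasing => //.
  - move=> x y; rewrite in_itv/= => /andP[nx _] _; apply: phiincr.
    by rewrite (le_trans _ nx)// ltW.
  - move=> x; rewrite in_itv/= => /andP[nx _]; apply: cdphi.
    exact: lt_trans nx.
  - by apply: cvgP; apply: cvg_at_right_filter; apply: cdphi.
  - by apply: cvgP; apply: cvg_at_left_filter; apply: cdphi.
  - split.
    + move=> x; rewrite in_itv/= => /andP[nx _]; have x0 := lt_trans n0 nx.
      exact: (@ex_derive _ _ _ _ _ _ _ (dphi x x0)).
    + by apply: cvg_at_right_filter; apply: cphi.
    + by apply: cvg_at_left_filter; apply: cphi.
  - apply: continuous_in_subspaceT => x; rewrite inE/= in_itv/= => /andP[nx _].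
    by apply: cG; rewrite in_itv/= andbT (lt_le_trans _ nx)// phigt0.
have psi y : 0 < y -> exists2 x, 0 < x & phi x = y.
  move=> y0; exists ((y / c) `^ s^-1); first by rewrite powR_gt0// divr_gt0.
  rewrite /phi -powRrM mulVf ?gt_eqF// powRr1 ?divr_ge0 1?ltW//.
  by rewrite mulrC divfK// gt_eqF.
have nV (m n : nat) : (m <= n)%N -> l n <= l m.
  by move=> mn; rewrite /l lef_pV2 ?posrE// ler_nat.
have phile x y : 0 <= x -> x <= y -> phi x <= phi y.
  move=> x0; rewrite le_eqVlt => /predU1P[->//|xy]; exact/ltW/phiincr.
have bigU : \bigcup_n `[l n, u n]%classic = `]0, +oo[%classic :> set R.
  apply/seteqP; split => x /=.
    by move=> [n _]/=; rewrite !in_itv/= andbT => /andP[+ _];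
      apply: lt_le_trans; exact: l0.
  by rewrite in_itv/= andbT => /(exists_nat_between x)[n nx]; exists n.
have bigphi : \bigcup_n `[phi (l n), phi (u n)]%classic = `]0, +oo[%classic :> set R.
  apply/seteqP; split => x /=.
    move=> [n _]/=; rewrite !in_itv/= andbT => /andP[+ _]; apply: lt_le_trans.
    exact: phigt0.
  rewrite in_itv/= andbT => /(psi x)[y y0 <-].
  have [n /andP[ny yn]] := exists_nat_between y y0; exists n => //=.
  by rewrite in_itv/= (phile _ _ (ltW (l0 n)) ny) (phile _ _ (ltW y0) yn).
have mG : measurable_fun (`]0, +oo[ : set R) G.
  by apply: open_continuous_measurable_fun => // x; rewrite inE; exact: cG.
have mH : measurable_fun (`]0, +oo[ : set R) ((G \o phi) * phi^`()%classic).
  apply: open_continuous_measurable_fun => // x; rewrite inE/= in_itv/= andbT => x0.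
  apply: cvgM; last exact: cdphi.
  apply: continuous_comp; first exact: cphi.
  by apply: cG; rewrite in_itv/= andbT phigt0.
transitivity (\int[mu]_(x in `]0%R, +oo[)
    (((G \o phi) * phi^`()%classic) x)%:E)%E; last first.
  by apply: eq_integral => x; rewrite inE/= in_itv/= andbT => x0; rewrite fctE/= dphiE.
have subphi n : `[phi (l n), phi (u n)] `<=` `]0, +oo[.
  by move=> x xn; rewrite -bigphi; exists n.
have subU n : `[l n, u n] `<=` `]0, +oo[.
  by move=> x xn; rewrite -bigU; exists n.
have un (m n : nat) : (m <= n)%N -> u m <= u n by rewrite /u ler_nat.
rewrite -{1}bigphi -bigU.
have limG : (\int[mu]_(x in `[phi (l n), phi (u n)]) (G x)%:E)%E @[n --> \oo] -->
    (\int[mu]_(x in \bigcup_n `[phi (l n), phi (u n)]%classic) (G x)%:E)%E.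
  apply: ge0_nondecreasing_set_cvg_integral => //.
  - move=> m n mn; rewrite subsetEset; apply: subset_itv; rewrite bnd_simp.
      exact: phile (ltW (l0 n)) (nV _ _ mn).
    exact: phile (ltW (u0 m)) (un _ _ mn).
  - by move=> n; apply/measurable_EFinP; apply: measurable_funS mG.
  - move=> n x /subphi/=; rewrite in_itv/= andbT lee_fin; exact: G0.
have limH : (\int[mu]_(x in `[l n, u n]) (((G \o phi) * phi^`()%classic) x)%:E)%E
    @[n --> \oo] --> (\int[mu]_(x in \bigcup_n `[l n, u n]%classic)
      (((G \o phi) * phi^`()%classic) x)%:E)%E.
  apply: ge0_nondecreasing_set_cvg_integral => //.
  - move=> m n mn; rewrite subsetEset; apply: subset_itv; rewrite bnd_simp.
      exact: nV.
    exact: un.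
  - by move=> n; apply/measurable_EFinP; apply: measurable_funS mH.
  - move=> n x /subU/=; rewrite in_itv/= andbT lee_fin => x0; rewrite fctE/= dphiE//.
    apply: mulr_ge0; first exact/G0/phigt0.
    by rewrite mulr_ge0 ?powR_ge0// mulr_ge0// ltW.
apply: (cvg_unique _ limG); first exact: ereal_hausdorff.
by rewrite (_ : (fun _ => _) = (fun n => \int[mu]_(x in `[l n, u n])
  (((G \o phi) * phi^`()%classic) x)%:E)%E)//; apply/funext => n; exact: sub.
Unshelve. all: by end_near.
Qed.
End HalfLine.
(** * Gamma and Beta integrals *)

Section GammaIntegrals.
Context {R : realType}.
Implicit Types (a b c m s t w x y z : R).
Notation mu := (@lebesgue_measure R).

Lemma gt0_powRD x a b : 0 < x -> x `^ (a + b) = x `^ a * x `^ b.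
Proof. by move=> x0; rewrite powRD// (gt_eqF x0) implybT. Qed.

Lemma powR_le1 x a : 0 <= x <= 1 -> 0 <= a -> x `^ a <= 1.
Proof.
move=> /andP[x0 x1] a0.
have -> : 1 = 1 `^ a :> R by rewrite powR1.
by rewrite ge0_ler_powR// nnegrE.
Qed.

Definition gamma_integrand z t : R := expR (- t) * t `^ (z - 1).

(** [Gamma z] would be [0] if this integral were infinite; the extended-real
    value is kept until it is known to be finite. *)
Definition Gamma_ereal z : \bar R :=
  (\int[mu]_(t in `]0%R, +oo[) (gamma_integrand z t)%:E)%E.

Lemma gamma_integrand_ge0 z t : 0 <= gamma_integrand z t.
Proof. by rewrite mulr_ge0 ?expR_ge0 ?powR_ge0. Qed.

Lemma gamma_integrand_continuous z : {in `]0, +oo[, continuous (gamma_integrand z)}.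
Proof.
move=> t; rewrite in_itv/= andbT => t0.
apply: (@continuousM _ _ (fun t => expR (- t)) (fun t => t `^ (z - 1))).
  by apply: continuous_comp; [exact: continuousN|exact: continuous_expR].
exact: powR_continuous.
Qed.

Lemma gamma_integrand_measurable z (D : set R) : measurable_fun D (gamma_integrand z).
Proof.
apply: measurable_funTS; apply: measurable_funM.
  by apply: measurableT_comp.
exact: measurable_powR.
Qed.

(** The substitution [t = s^(1/z)] absorbs the power of [t], which is singular at
    [0] when [z < 1], and leaves a bounded integrand. *)
Lemma Gamma_ereal_power z : 0 < z -> Gamma_ereal z =
  (\int[mu]_(t in `]0%R, +oo[) (z^-1 * expR (- (t `^ z^-1)))%:E)%E.
Proof.
move=> z0; rewrite /Gamma_ereal (@ge0_integral_monomial _ 1 z^-1) ?invr_gt0//.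
- apply: eq_integral => x; rewrite inE/= in_itv/= andbT => x0; congr EFin.
  rewrite !mul1r /gamma_integrand mulrCA -mulrA; congr (_ * _).
  rewrite -powRrM -gt0_powRD//.
  have -> : z^-1 * (z - 1) + (z^-1 - 1) = 0.
    by rewrite mulrBr mulVf ?gt_eqF//; ring.
  by rewrite powRr0 mulr1.
- exact: gamma_integrand_continuous.
- by move=> x x0; exact: gamma_integrand_ge0.
Qed.

(** The exponential of a positive power dominates [1 + t^2], whose inverse has a
    known finite integral. *)
Lemma oneDsqr_le_expR_powR w : 0 < w ->
  exists2 C : R, 0 < C & forall t, 0 < t -> oneDsqr t <= C * expR (t `^ w).
Proof.
move=> w0; pose n := Num.truncn (2 / w).
(* [v = t^w] gives [t^2 = v^(2/w)], which is at most [v^(n+1) <= (n+1)! e^v]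
   when [1 <= v], and at most [1] otherwise. *)
exists (2 + n.+1`!%:R); first by rewrite addr_gt0.
move=> t t0; set v := t `^ w; have v0 : 0 < v by exact: powR_gt0.
have ev1 : 1 <= expR v by rewrite ltW// expR_gt1.
have tv : t ^+ 2 = v `^ (2 / w).
  by rewrite /v -powRrM mulrCA divff ?gt_eqF// mulr1 -powR_mulrn// ltW.
have t2 : t ^+ 2 <= 1 + n.+1`!%:R * expR v.
  have [v1|v1] := leP v 1.
    rewrite tv (@le_trans _ _ 1) ?lerDl ?mulr_ge0 ?expR_ge0//.
    by rewrite powR_le1 ?divr_ge0 ?v1 ?andbT// ltW.
  rewrite tv (@le_trans _ _ (v `^ n.+1%:R))//.
    by rewrite ler_powR ?ltW// truncnS_gt.
  rewrite powR_mulrn ?(ltW v0)//.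
  rewrite (@le_trans _ _ (n.+1`!%:R * expR v)) ?lerDr//.
  rewrite -ler_pdivrMl ?ltr0n ?fact_gt0// mulrC.
  by rewrite (le_trans _ (expR_ge1Dxn n (ltW v0))) ?lerDr.
rewrite /oneDsqr mulrDl; lra.
Qed.


Lemma Gamma_ereal_lty z : 0 < z -> (Gamma_ereal z < +oo)%E.
Proof.
move=> z0; rewrite Gamma_ereal_power//.
have zV0 : 0 < z^-1 by rewrite invr_gt0.
have [C C0 HC] := oneDsqr_le_expR_powR z^-1 zV0.
have oD0 t : 0 < oneDsqr t by rewrite (lt_le_trans ltr01)// oneDsqr_ge1.
have moD (D : set R) : measurable_fun D (fun t : R => (oneDsqr t)^-1).
  apply: measurable_funTS; apply: continuous_measurable_fun.
  exact: continuous_oneDsqrV.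
apply: (@le_lt_trans _ _ (\int[mu]_(t in `]0%R, +oo[)
    ((z^-1 * C)%:E * (oneDsqr t)^-1%:E))%E).
  apply: ge0_le_integral => //.
  - by move=> t _; rewrite lee_fin mulr_ge0 ?expR_ge0// ltW.
  - apply/measurable_EFinP; apply: measurable_funM => //.
    apply: measurableT_comp => //; apply: measurableT_comp => //.
    exact: measurable_funTS.
  - apply: measurable_funeM; apply/measurable_EFinP; exact: moD.
  - move=> t; rewrite /= in_itv/= andbT => t0; rewrite -EFinM lee_fin.
    rewrite -mulrA ler_pM2l// expRN ler_pdivlMr// mulrC ler_pdivrMr ?expR_gt0//.
    exact: HC.
rewrite ge0_integralZl_EFin//; last 2 first.
- apply/measurable_EFinP; exact: moD.
- by rewrite mulr_ge0 ?ltW.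
rewrite integral_itv_obnd_cbnd; last by apply/measurable_EFinP; exact: moD.
by rewrite integral0y_oneDsqr -EFinM ltry.
Qed.

Lemma Gamma_ereal_gt0 z : 0 < z -> (0 < Gamma_ereal z)%E.
Proof.
move=> z0; rewrite Gamma_ereal_power//.
have zV0 : 0 < z^-1 by rewrite invr_gt0.
have mf (D : set R) : measurable_fun D (fun t => (z^-1 * expR (- (t `^ z^-1)))%:E).
  apply/measurable_EFinP; apply: measurable_funM => //.
  apply: measurableT_comp => //; apply: measurableT_comp => //.
  exact: measurable_funTS.
apply: (@lt_le_trans _ _ (\int[mu]_(t in `]0%R, 1%R]) (z^-1 * expR (- 1))%:E)%E).
  rewrite integral_cst//= lebesgue_measure_itv/= lte_fin ltr01 oppr0 adde0 mule1.
  by rewrite lte_fin mulr_gt0 ?expR_gt0.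
apply: (@le_trans _ _ (\int[mu]_(t in `]0%R, 1%R]) (z^-1 * expR (- (t `^ z^-1)))%:E)%E).
  apply: ge0_le_integral => //.
  - by move=> t _; rewrite lee_fin mulr_ge0 ?expR_ge0// ltW.
  - exact: mf.
  - move=> t; rewrite /= in_itv/= => /andP[t0 t1]; rewrite lee_fin ler_pM2l//.
    rewrite ler_expR lerN2 powR_le1// ?t1 ?andbT; exact: ltW.
apply: ge0_subset_integral => //.
- exact: mf.
- by move=> t _; rewrite lee_fin mulr_ge0 ?expR_ge0// ltW.
- by apply: subset_itvl.
Qed.

(** The Laplace transform of [t^(z-1)], by the substitution [c t]. *)
Lemma integral_gamma_scale c z : 0 < c -> 0 < z ->
  (\int[mu]_(t in `]0%R, +oo[) (expR (- (c * t)) * t `^ (z - 1))%:E =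
   (c `^ (- z))%:E * Gamma_ereal z)%E.
Proof.
move=> c0 z0; rewrite /Gamma_ereal (@ge0_integral_monomial _ c 1)//; last 2 first.
- exact: gamma_integrand_continuous.
- by move=> x x0; exact: gamma_integrand_ge0.
rewrite -ge0_integralZl_EFin ?powR_ge0//; last 2 first.
- move=> x; rewrite /= in_itv/= andbT => x0.
  by rewrite lee_fin mulr_ge0 ?gamma_integrand_ge0// mulr_ge0 ?powR_ge0// mulr1 ltW.
- apply/measurable_EFinP; apply: measurable_funM.
    apply: (measurableT_comp (gamma_integrand_measurable z setT)).
    by apply: measurable_funM => //; exact: measurable_funTS.
  by apply: measurable_funM => //; exact: measurable_funTS.
apply: eq_integral => x; rewrite inE/= in_itv/= andbT => x0.
rewrite -EFinM; congr EFin.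
rewrite /gamma_integrand subrr powRr0 !mulr1 powRr1 ?ltW// powRM ?ltW//.
have ccz : c `^ (- z) * (c `^ (z - 1) * c) = 1.
  rewrite -{3}(powRr1 (ltW c0)) -!gt0_powRD// (_ : - z + _ = 0) ?powRr0//; ring.
rewrite -[LHS]mul1r -{1}ccz; ring.
Qed.

Lemma ge0_integral_swap (D : set R) (H : R * R -> R) :
  measurable D -> measurable_fun setT H ->
  (forall x y, D x -> D y -> 0 <= H (x, y)) ->
  (\int[mu]_(x in D) \int[mu]_(y in D) (H (x, y))%:E =
   \int[mu]_(y in D) \int[mu]_(x in D) (H (x, y))%:E)%E.
Proof.
move=> mD mH H0.
pose f := (EFin \o H) \_ (D `*` D).
have mf : measurable_fun setT f.
  apply/(measurable_restrictT _ (measurableX mD mD)).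
  by apply/measurable_EFinP; exact: measurable_funTS.
have f0 u : (0 <= f u)%E.
  by apply: erestrict_ge0 => -[x y] [/= Dx Dy]; rewrite lee_fin H0.
have := @fubini_tonelli _ _ _ _ _ mu mu f mf f0.
have -> : (\int[mu]_x \int[mu]_y f (x, y) =
    \int[mu]_(x in D) \int[mu]_(y in D) (H (x, y))%:E)%E.
  rewrite [RHS]integral_mkcond; apply: eq_integral => x _.
  rewrite patchE; case: ifPn => xD.
    rewrite [RHS]integral_mkcond; apply: eq_integral => y _.
    by rewrite /f !patchE in_setX/= xD.
  by apply: integral0_eq => y _; rewrite /f patchE in_setX/= (negbTE xD).
move=> ->.
rewrite [RHS]integral_mkcond; apply: eq_integral => y _.
rewrite patchE; case: ifPn => yD.
  rewrite [RHS]integral_mkcond; apply: eq_integral => x _.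
  by rewrite /f !patchE in_setX/= yD andbT.
by apply: integral0_eq => x _; rewrite /f patchE in_setX/= (negbTE yD) andbF.
Qed.

Lemma ge0_integralZl_halfline c (h : R -> R) : 0 <= c ->
  measurable_fun (`]0, +oo[ : set R) h -> (forall x, 0 < x -> 0 <= h x) ->
  (\int[mu]_(x in `]0%R, +oo[) (c * h x)%:E =
   c%:E * \int[mu]_(x in `]0%R, +oo[) (h x)%:E)%E.
Proof.
move=> c0 mh h0; rewrite -ge0_integralZl_EFin//.
- by move=> x; rewrite /= in_itv/= andbT lee_fin; exact: h0.
- exact/measurable_EFinP.
Qed.

Lemma measurable_scaled_gamma_integrand c z (D : set R) :
  measurable_fun D (fun t => expR (- (c * t)) * t `^ (z - 1)).
Proof.
apply: measurable_funTS; apply: measurable_funM => //.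
by apply: measurableT_comp => //; apply: measurableT_comp.
Qed.

Lemma Gamma_erealE z : 0 < z -> Gamma_ereal z = (Gamma z)%:E.
Proof.
move=> z0; rewrite [RHS]fineK// ge0_fin_numE ?Gamma_ereal_lty//.
exact/ltW/Gamma_ereal_gt0.
Qed.

Lemma Gamma_gt0 z : 0 < z -> 0 < Gamma z.
Proof. by move=> z0; rewrite -lte_fin -Gamma_erealE// Gamma_ereal_gt0. Qed.

(** By the Laplace transform of [t^(k-1)], the left-hand side is the double
    integral of [t^(k-1) y^(m-1) exp (- (a + b y) t)]; integrating in [y] first
    gives a Gamma integral in [b t], and what remains is a Gamma integral in
    [a t]. *)
Lemma beta_integral a b m k : 0 < a -> 0 < b -> 0 < m -> m < k ->
  ((Gamma k)%:E *
     \int[mu]_(y in `]0%R, +oo[) (y `^ (m - 1) * (a + b * y) `^ (- k))%:E =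
   (b `^ (- m) * a `^ (m - k) * (Gamma m * Gamma (k - m)))%:E)%E.
Proof.
move=> a0 b0 m0 mk; have k0 : 0 < k by exact: lt_trans mk.
have km0 : 0 < k - m by rewrite subr_gt0.
pose H (u : R * R) : R :=
  u.1 `^ (k - 1) * u.2 `^ (m - 1) * expR (- ((a + b * u.2) * u.1)).
have m1 : measurable_fun setT (fun u : R * R => u.1) by exact: measurable_fst.
have m2 : measurable_fun setT (fun u : R * R => u.2) by exact: measurable_snd.
have mH : measurable_fun setT H.
  apply: measurable_funM; first apply: measurable_funM.
  - apply: (@measurableT_comp _ _ _ _ _ _ (fun y : R => y `^ (k - 1))) m1.
    exact: measurable_powR.
  - apply: (@measurableT_comp _ _ _ _ _ _ (fun y : R => y `^ (m - 1))) m2.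
    exact: measurable_powR.
  - apply: measurableT_comp => //; apply: measurableT_comp => //.
    apply: measurable_funM => //; apply: measurable_funD => //.
    exact: measurable_funM.
have H0 (x y : R) : `]0%R, +oo[%classic x -> `]0%R, +oo[%classic y -> 0 <= H (x, y).
  by move=> _ _; rewrite !mulr_ge0 ?powR_ge0 ?expR_ge0.
have mD : measurable (`]0, +oo[ : set R) by [].
have powD s (D : set R) : measurable_fun D (fun y : R => y `^ s).
  exact: measurable_funTS.
have := ge0_integral_swap _ H mD mH H0.
have inner_y t : 0 < t -> (\int[mu]_(y in `]0%R, +oo[) (H (t, y))%:E =
    (b `^ (- m) * Gamma m * (expR (- (a * t)) * t `^ (k - m - 1)))%:E)%E.
  move=> t0; have bt0 : 0 < b * t by rewrite mulr_gt0.
  transitivity (\int[mu]_(y in `]0%R, +oo[) (t `^ (k - 1) * expR (- (a * t)) *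
      (expR (- ((b * t) * y)) * y `^ (m - 1)))%:E)%E.
    apply: eq_integral => y _; congr EFin; rewrite /H/=.
    have -> : - ((a + b * y) * t) = - (a * t) + - (b * t * y) by ring.
    by rewrite expRD; ring.
  rewrite ge0_integralZl_halfline ?mulr_ge0 ?powR_ge0 ?expR_ge0//; last 2 first.
  - exact: measurable_scaled_gamma_integrand.
  - by move=> y y0; rewrite mulr_ge0 ?powR_ge0 ?expR_ge0.
  rewrite integral_gamma_scale// Gamma_erealE// -!EFinM; congr EFin.
  have -> : k - m - 1 = (k - 1) + - m by ring.
  rewrite (@gt0_powRD t (k - 1) (- m))// powRM ?ltW//; ring.
have inner_t y : 0 < y -> (\int[mu]_(t in `]0%R, +oo[) (H (t, y))%:E =
    (Gamma k * (y `^ (m - 1) * (a + b * y) `^ (- k)))%:E)%E.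
  move=> y0; have aby0 : 0 < a + b * y by rewrite addr_gt0// mulr_gt0.
  transitivity (\int[mu]_(t in `]0%R, +oo[) (y `^ (m - 1) *
      (expR (- ((a + b * y) * t)) * t `^ (k - 1)))%:E)%E.
    by apply: eq_integral => t _; congr EFin; rewrite /H/=; ring.
  rewrite ge0_integralZl_halfline ?powR_ge0//; last 2 first.
  - exact: measurable_scaled_gamma_integrand.
  - by move=> t t0; rewrite mulr_ge0 ?powR_ge0 ?expR_ge0.
  rewrite integral_gamma_scale// Gamma_erealE// -!EFinM; congr EFin; ring.
have -> : (\int[mu]_(t in `]0%R, +oo[) \int[mu]_(y in `]0%R, +oo[) (H (t, y))%:E =
    (b `^ (- m) * a `^ (m - k) * (Gamma m * Gamma (k - m)))%:E)%E.
  transitivity (\int[mu]_(t in `]0%R, +oo[)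
      (b `^ (- m) * Gamma m * (expR (- (a * t)) * t `^ (k - m - 1)))%:E)%E.
    by apply: eq_integral => t; rewrite inE/= in_itv/= andbT; exact: inner_y.
  rewrite ge0_integralZl_halfline ?mulr_ge0 ?powR_ge0 ?(ltW (Gamma_gt0 _ m0))//; last 2 first.
  - exact: measurable_scaled_gamma_integrand.
  - by move=> t t0; rewrite mulr_ge0 ?powR_ge0 ?expR_ge0.
  rewrite integral_gamma_scale// Gamma_erealE// opprB -!EFinM; congr EFin; ring.
move=> ->.
rewrite -ge0_integralZl_halfline ?(ltW (Gamma_gt0 _ k0))//; last 2 first.
- apply: measurable_funM => //; apply: measurable_funTS.
  apply: (@measurableT_comp _ _ _ _ _ _ (fun y : R => y `^ (- k))).
    exact: measurable_powR.
  by apply: measurable_funD => //; exact: measurable_funM.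
- by move=> y y0; rewrite mulr_ge0 ?powR_ge0.
by apply: eq_integral => y; rewrite inE/= in_itv/= andbT => y0; rewrite inner_t.
Qed.

Lemma powR_inv x s : 0 <= x -> x^-1 `^ s = x `^ (- s).
Proof. by move=> x0; rewrite -powR_inv1// -powRrM mulN1r. Qed.

(** Factoring [x^p] out of the sum leaves a function of [x^(q-p)] alone, to which
    the substitution [y = x^(q-p)] and the Beta integral apply. *)
Lemma integral_inv_power_sum a b p q k : 0 < a -> 0 < b -> 0 < k ->
  k * p < 1 -> 1 < k * q ->
  let mp := (1 - k * p) / (q - p) in
  let mq := (k * q - 1) / (q - p) in
  (\int[mu]_(x in `]0%R, +oo[) ((a * x `^ p + b * x `^ q) `^ k)^-1%:E =
   (Gamma mp * Gamma mq / (a `^ k * Gamma k * (q - p)) * (a / b) `^ mp)%:E)%E.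
Proof.
move=> a0 b0 k0 kp kq mp mq.
have pq : p < q by rewrite -(ltr_pM2l k0) (lt_trans kp).
pose r := q - p; have r0 : 0 < r by rewrite subr_gt0.
have mp0 : 0 < mp by rewrite divr_gt0 ?subr_gt0.
have mq0 : 0 < mq by rewrite divr_gt0 ?subr_gt0.
have kE : k - mp = mq by rewrite /mp /mq; field; rewrite subr_eq0 gt_eqF.
have mpk : mp < k by rewrite -subr_gt0 kE.
have rmp : r * mp = 1 - k * p by rewrite /r /mp; field; rewrite subr_eq0 gt_eqF.
have := beta_integral _ _ _ _ a0 b0 mp0 mpk; rewrite kE.
have aby0 y : 0 < y -> 0 < a + b * y by move=> y0; rewrite addr_gt0// mulr_gt0.
rewrite (@ge0_integral_monomial _ 1 r)//; last 2 first.
- move=> y; rewrite in_itv/= andbT => y0.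
  apply: (@continuousM _ _ (fun y => y `^ (mp - 1)) (fun y => (a + b * y) `^ (- k))).
    exact: powR_continuous.
  apply: (@continuous_comp _ _ _ (fun y => a + b * y) (fun y => y `^ (- k))).
    apply: continuousD; first exact: cst_continuous.
    exact: mulrl_continuous.
  by apply: powR_continuous; exact: aby0.
- by move=> y y0; rewrite mulr_ge0 ?powR_ge0.
have -> : (\int[mu]_(x in `]0%R, +oo[)
    ((1 * x `^ r) `^ (mp - 1) * (a + b * (1 * x `^ r)) `^ (- k) *
      (1 * r * x `^ (r - 1)))%:E =
   r%:E * \int[mu]_(x in `]0%R, +oo[) ((a * x `^ p + b * x `^ q) `^ k)^-1%:E)%E.
  rewrite -ge0_integralZl_halfline ?(ltW r0)//; last 2 first.
  - apply: measurable_funTS; under eq_fun do rewrite -powRN.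
    apply: (@measurableT_comp _ _ _ _ _ _ (fun y : R => y `^ (- k))).
      exact: measurable_powR.
    by apply: measurable_funD; apply: measurable_funM.
  - by move=> x x0; rewrite invr_ge0 powR_ge0.
  apply: eq_integral => x; rewrite inE/= in_itv/= andbT => x0; congr EFin.
  rewrite !mul1r; set S := a + b * x `^ r.
  have S0 : 0 < S by rewrite aby0 ?powR_gt0.
  have -> : a * x `^ p + b * x `^ q = x `^ p * S.
    have -> : q = p + r by rewrite /r; ring.
    rewrite gt0_powRD// /S; ring.
  rewrite powRM ?powR_ge0 ?(ltW S0)// invfM -!powRN -!powRrM.
  have -> : x `^ (p * - k) = x `^ (r * (mp - 1)) * x `^ (r - 1).
    rewrite -gt0_powRD//; congr (_ `^ _); rewrite mulrBr rmp; ring.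
  ring.
set I := (\int[mu]_(x in _) _)%E.
have Gk := Gamma_gt0 _ k0.
move=> E; have -> : I = ((Gamma k * r)^-1%:E * ((Gamma k)%:E * (r%:E * I)))%E.
  by rewrite !muleA -!EFinM -mulrA mulVf ?mul1e// mulf_neq0// gt_eqF.
rewrite E -EFinM; congr EFin.
rewrite powRM ?invr_ge0 ?ltW// powR_inv ?ltW// (@gt0_powRD a mp (- k))// !powRN -/r.
(* Only a rational identity between positive numbers is left. *)
have := powR_gt0 mp b0; have := powR_gt0 k a0; move: Gk r0.
clear -R; move: (r : R).
move: (Gamma k) (Gamma mp) (Gamma mq) (a `^ k) (a `^ mp) (b `^ mp).
move=> gk gp gq ak ap bp s gk0 s0 ak0 bp0.
by field; rewrite !gt_eqF.
Qed.

End GammaIntegrals.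
(** * Forward uniqueness for a nonincreasing vector field *)

Section ForwardUniqueness.
Context {R : realType}.
Implicit Types (f x y : R -> R) (a t s : R) (b : \bar R).

Lemma is_derive1_quotientP f t (l : R) :
  is_derive t 1 f l <-> (s - t)^-1 *: (f s - f t) @[s --> t^'] --> l.
Proof.
rewrite is_derive1_caratheodory; split.
  move=> [phi [fE /continuous_withinNx cphi <-]].
  apply: cvg_trans cphi; apply: near_eq_cvg; near=> s.
  have st : s - t != 0 by rewrite subr_eq0; near: s; exact: nbhs_dnbhs_neq.
  by rewrite fE /GRing.scale/= mulrC mulfK.
move=> fl; exists (fun s => if s == t then l else (s - t)^-1 *: (f s - f t)).
split; last by rewrite eqxx.
- move=> s; case: eqP => [->|/eqP st]; first by rewrite !subrr mulr0.
  by rewrite /GRing.scale/= mulrC mulVKf// subr_eq0.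
- apply/continuous_withinNx; rewrite eqxx.
  apply: cvg_trans fl; apply: near_eq_cvg; near=> s.
  have /negbTE -> // : s != t by near: s; exact: nbhs_dnbhs_neq.
Unshelve. all: by end_near.
Qed.

Lemma time_domain_oo_near b t : 0 < t -> (t%:E < b)%E ->
  \forall s \near t, time_domain b s.
Proof.
move=> t0; case: b => [r| |]//; rewrite ?lte_fin => tb; near=> s.
  split; first by apply: ltW; near: s; exact: lt_nbhsr.
  by rewrite lte_fin; near: s; exact: lt_nbhsl.
by split; [apply: ltW; near: s; exact: lt_nbhsr|rewrite ltry].
Unshelve. all: by end_near.
Qed.

Lemma time_domain_right_near b : (0 < b)%E -> \forall s \near 0^'+, time_domain b s.
Proof.
case: b => [r| |]//; rewrite ?lte_fin => b0; near=> s.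
  by split; [exact: ltW|rewrite lte_fin; near: s; exact: nbhs_right_lt].
by split; [exact: ltW|rewrite ltry].
Unshelve. all: by end_near.
Qed.

(** At a positive time the domain is a neighbourhood, so the derivative relative
    to the domain is a two-sided one. *)
Lemma solution_derive f a b x t : solution f a b x -> 0 < t -> (t%:E < b)%E ->
  is_derive t 1 x (f (x t)).
Proof.
move=> [_ _ xf] t0 tb; apply/is_derive1_quotientP.
apply: cvg_trans (xf t _); last by split => //; exact: ltW.
move=> A; rewrite /= !nbhs_filterE /within/= => nA.
have Dt : \forall s \near t^', time_domain b s.
  by apply: nbhs_dnbhs; exact: time_domain_oo_near.
by apply: filterS2 nA Dt => s nAs; exact: nAs.
Qed.

Lemma solution_right_continuous f a b x : solution f a b x -> x s @[s --> 0^'+] --> x 0.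
Proof.
move=> [b0 _ /(_ 0) xf]; pose q s := (s - 0)^-1 *: (x s - x 0).
have {xf}qf : q s @[s --> 0^'+] --> f (x 0).
  apply: cvg_trans (xf _); last by split.
  move=> A nA; have {}nA : \forall s \near 0^', time_domain b s -> A (q s) by exact: nA.
  have D0 := time_domain_right_near b b0.
  have {}nA : \forall s \near 0^'+, time_domain b s -> A (q s).
    move: nA; rewrite !near_withinE; apply: filterS => s /= nAs s0.
    by apply: nAs; rewrite gt_eqF.
  by apply: filterS2 nA D0 => s nAs; exact: nAs.
have -> : x 0 = x 0 + 0 * f (x 0) by rewrite mul0r addr0.
apply: (@cvg_trans _ ((fun s => x 0 + s * q s) s @[s --> 0^'+])).
  apply: near_eq_cvg; near=> s.
  have s0 : s != 0 by rewrite gt_eqF.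
  by rewrite /q subr0 /GRing.scale/= mulVKf// subrKC.
apply: cvgD; first exact: cvg_cst.
apply: cvgM; last exact: qf.
exact: cvg_at_right_filter.
Unshelve. all: by end_near.
Qed.

(** The derivative of [(x - y)^2] is [2 (x - y) (f x - f y)], which is nonpositive
    when [f] is nonincreasing, and [x 0 = y 0]. *)
Lemma solution_unique f a b x y : {homo f : u v /~ u <= v} ->
  solution f a b x -> solution f a b y -> forall t, time_domain b t -> x t = y t.
Proof.
move=> fni sx sy t [t0 tb].
have [x0 y0] : x 0 = a /\ y 0 = a by case: sx; case: sy.
move: t0; rewrite le_eqVlt => /predU1P[<-|t0]; first by rewrite x0 y0.
pose V s := (x s - y s) ^+ 2.
have dV s : 0 < s -> (s%:E < b)%E ->
    is_derive s 1 V (2 * (x s - y s) * (f (x s) - f (y s))).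
  move=> s0 sb.
  have dx := solution_derive _ _ _ _ _ sx s0 sb.
  have dy := solution_derive _ _ _ _ _ sy s0 sb.
  apply: is_derive_eq; rewrite /GRing.scale/=; ring.
have Vni : V t <= V 0.
  have sb s : s <= t -> (s%:E < b)%E.
    by move=> st; apply: le_lt_trans tb; rewrite lee_fin.
  apply: (@ler0_derive1_le_cc _ V 0 t).
  - by move=> s; rewrite in_itv/= => /andP[s0 st]; have [] := dV s s0 (sb _ (ltW st)).
  - move=> s; rewrite in_itv/= => /andP[s0 st]; rewrite derive1E.
    have [_ ->] := dV s s0 (sb _ (ltW st)).
    rewrite -mulrA pmulr_rle0//.
    have [xy|/ltW yx] := leP (x s) (y s).
      by rewrite mulr_le0_ge0 ?subr_le0 ?subr_ge0// fni.
    by rewrite mulr_ge0_le0 ?subr_le0 ?subr_ge0// fni.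
  - apply/(continuous_within_itvP _ t0); split.
    + move=> s; rewrite in_itv/= => /andP[s0 st].
      exact: is_derive1_continuous (dV s s0 (sb _ (ltW st))).
    + have xy0 : x s - y s @[s --> 0^'+] --> x 0 - y 0.
        apply: cvgB.
          exact: solution_right_continuous sx.
        exact: solution_right_continuous sy.
      by rewrite /V expr2; apply: cvgM.
    + apply: cvg_at_left_filter.
      exact: is_derive1_continuous (dV t t0 tb).
  - by rewrite in_itv/= lexx ltW.
  - by rewrite in_itv/= lexx ltW.
  - exact: ltW.
move: Vni; rewrite /V x0 y0 subrr expr0n/= => V0.
by apply/eqP; rewrite -subr_eq0 -sqrf_eq0 eq_le V0 sqr_ge0.
Qed.

End ForwardUniqueness.

(** * Decay to the origin at a prescribed speed *)

Section ScalarFlow.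
Context {R : realType}.
Implicit Types (x : R -> R) (a t u y z : R).
Notation mu := (@lebesgue_measure R).

Context (g : R -> R) (g_0 : g 0 = 0) (g_gt0 : forall y, 0 < y -> 0 < g y)
  (g_nd : forall y z, 0 <= y -> y <= z -> g y <= g z)
  (g_cont : forall y, 0 < y -> {for y, continuous g})
  (g_cvg0 : g y @[y --> 0^'+] --> 0)
  (g_int : mu.-integrable `[0, +oo[ (fun y => (g y)^-1%:E)).

(** The time needed to go from [y] down to [0] at speed [g].  The integrand takes
    the harmless value [0] at [0], where [g] vanishes. *)
Definition travel_time y : R := parameterized_integral mu 0 y (fun z => (g z)^-1).

Local Notation F := travel_time.

Lemma travel_time_le0 y : y <= 0 -> F y = 0.
Proof.
rewrite /F /parameterized_integral le_eqVlt => /predU1P[->|y0].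
  by rewrite set_itv1 Rintegral_set1.
by rewrite set_itv_ge ?Rintegral_set0// bnd_simp -ltNge.
Qed.

Lemma travel_time0 : F 0 = 0.
Proof. exact: travel_time_le0. Qed.

Lemma integrable_slowness a : mu.-integrable `[0, a] (EFin \o (fun y => (g y)^-1)).
Proof. by apply: integrableS g_int => //; exact: subset_itvl. Qed.

Lemma travel_time_derive y : 0 < y -> is_derive y 1 F (g y)^-1.
Proof.
move=> y0.
have cgV : {for y, continuous (fun z => (g z)^-1)}.
  by apply: cvgV; [rewrite gt_eqF// g_gt0|exact: g_cont].
have [dF FE] := @continuous_FTC1_closed _ _ 0 y (y + 1) (ltr_pwDr ltr01 (lexx y))
  (integrable_slowness (y + 1)) y0 cgV.
by split; [exact: dF|rewrite -derive1E FE].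
Qed.

Lemma travel_time_continuous a : 0 <= a -> {within `[0, a], continuous F}.
Proof.
move=> a0; exact: parameterized_integral_continuous a0 (integrable_slowness a).
Qed.

Lemma travel_time_incr y z : 0 <= y -> y < z -> F y < F z.
Proof.
move=> y0 yz; have z0 : 0 < z by exact: le_lt_trans yz.
apply: (@gtr0_derive1_lt_cc _ F 0 z) => //.
- by move=> u; rewrite in_itv/= => /andP[u0 _]; have [] := travel_time_derive u u0.
- move=> u; rewrite in_itv/= => /andP[u0 _]; rewrite derive1E.
  by have [_ ->] := travel_time_derive u u0; rewrite invr_gt0 g_gt0.
- exact/travel_time_continuous/ltW.
- by rewrite in_itv/= y0 ltW.
- by rewrite in_itv/= lexx ltW.
Qed.

Lemma travel_time_ge0 y : 0 <= F y.
Proof.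
have [/travel_time_le0->//|y0] := leP y 0.
by rewrite -travel_time0; exact/ltW/travel_time_incr.
Qed.

Lemma travel_time_gt0 y : 0 < y -> 0 < F y.
Proof.
by move=> y0; rewrite -travel_time0; exact: travel_time_incr.
Qed.

Lemma travel_time_inj y z : 0 <= y -> 0 <= z -> F y = F z -> y = z.
Proof.
move=> y0 z0; case: (ltgtP y z) => // [yz|zy] E.
  by have := travel_time_incr _ _ y0 yz; rewrite E ltxx.
by have := travel_time_incr _ _ z0 zy; rewrite E ltxx.
Qed.

Lemma travel_time_surj a u : 0 <= a -> 0 <= u <= F a ->
  exists2 y, 0 <= y <= a & F y = u.
Proof.
move=> a0 /andP[u0 ua].
have [|y] := IVT (v := u) a0 (travel_time_continuous a a0).
  by rewrite travel_time0 ge_min u0/= le_max ua orbT.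
by rewrite in_itv/= => ya Fy; exists y.
Qed.

(** The speed does not exceed [g y] on the way from [y] down to [0]. *)
Lemma le_speed_travel_time y : 0 < y -> y <= g y * F y.
Proof.
move=> y0; have gy := g_gt0 y y0.
have [|c] := MVT (df := fun z => (g z)^-1) y0 _ (travel_time_continuous y (ltW y0)).
  by move=> z; rewrite in_itv/= => /andP[z0 _]; exact: travel_time_derive.
rewrite in_itv/= => /andP[c0 cy]; rewrite travel_time0 !subr0 => ->.
rewrite mulrA ler_peMl ?(ltW y0)// ler_pdivlMr ?g_gt0// mul1r.
by apply: g_nd; exact: ltW.
Qed.

(** The position from which the origin is reached in time [u]: the inverse of the
    travel time, extended by [0] to the times that are not travel times, the negative ones
    among them. *)
Definition arrival u : R := xget 0 [set y | 0 <= y /\ F y = u].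

Local Notation G := arrival.

Lemma arrivalP a u : 0 <= a -> 0 <= u <= F a -> 0 <= G u <= a /\ F (G u) = u.
Proof.
move=> a0 ua; have [y ya Fy] := travel_time_surj a u a0 ua.
rewrite /G; case: xgetP => [z _ [z0 Fz]|/(_ y)[]]; last by split => //; case/andP: ya.
rewrite (travel_time_inj z y)//; last by rewrite Fz. by case/andP: ya.
Qed.

Lemma travel_timeK y : 0 <= y -> G (F y) = y.
Proof.
move=> y0; have [|] := arrivalP y (F y) y0; first by rewrite travel_time_ge0/=.
by move=> /andP[G0 _]; exact: travel_time_inj.
Qed.

Lemma arrival_le0 u : u <= 0 -> G u = 0.
Proof.
rewrite le_eqVlt => /predU1P[->|u0].
  by rewrite -{1}travel_time0 travel_timeK.
rewrite /G; case: xgetP => // z _ [_ Fz]; move: u0; rewrite -Fz ltNge.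
by rewrite travel_time_ge0.
Qed.

Lemma arrival_ge0 u : 0 <= G u.
Proof. by rewrite /G; case: xgetP => // z _ []. Qed.

(** For [0 < u] this is the derivative of an inverse function.  At [u = 0] the
    derivative is [g 0 = 0], because [arrival u / u <= g (arrival u)] and the
    right-hand side tends to [0] with [u]. *)
Lemma arrival_derive a u : 0 <= a -> u < F a -> is_derive u 1 G (g (G u)).
Proof.
move=> a0 ua; case: (ltgtP u 0) => [u0|u0|u0].
- rewrite arrival_le0 ?ltW// g_0.
  apply: (@near_eq_is_derive _ _ _ (cst 0)); rewrite ?oner_neq0//.
  by near=> v; rewrite arrival_le0// ltW//; near: v; exact: lt_nbhsl.
- have [|/andP[Gu0 Gua] FGu] := arrivalP a u a0; first by rewrite !ltW.
  have {Gu0}Gu0 : 0 < G u.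
    rewrite lt_neqAle Gu0 andbT; apply: contraTneq u0 => G0.
    by rewrite -FGu -G0 travel_time_le0// ltxx.
  rewrite -[X in is_derive X]FGu -[g (G u)]invrK.
  apply: is_derive_inverse.
  + by near=> y; apply: travel_timeK; rewrite ltW//; near: y; exact: lt_nbhsr.
  + near=> y; apply: is_derive1_continuous (travel_time_derive y _).
    by near: y; exact: lt_nbhsr.
  + exact: travel_time_derive.
  + by rewrite invr_neq0// gt_eqF// g_gt0.
- rewrite u0 arrival_le0// g_0; apply/is_derive1_quotientP.
  rewrite arrival_le0//; apply/cvgr0Pnorm_le => e e0.
  have [y y0 gye] : exists2 y, 0 < y & g y <= e.
    have /cvgr0Pnorm_le/(_ e e0) ge := g_cvg0.
    near (0:R)^'+ => y; have y0 : 0 < y by [].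
    exists y => //; rewrite (le_trans (ler_norm _))//; near: y; exact: ge.
  near=> v; rewrite !subr0 /GRing.scale/=.
  have vFy : v < F y.
    near: v; apply: nbhs_dnbhs; apply: lt_nbhsl; exact: travel_time_gt0.
  have [v0|v0] := leP v 0; first by rewrite arrival_le0// mulr0 normr0 ltW.
  have [|/andP[+ Gvy] FGv] := arrivalP y v (ltW y0); first by rewrite !ltW.
  rewrite le_eqVlt => /predU1P[<-|Gv0]; first by rewrite mulr0 normr0 ltW.
  rewrite ger0_norm ?mulr_ge0 ?invr_ge0 ?arrival_ge0 ?(ltW v0)//.
  rewrite mulrC ler_pdivrMr// (le_trans (le_speed_travel_time _ Gv0))// FGv.
  by rewrite ler_wpM2r ?(ltW v0)// (le_trans _ gye)// g_nd// ltW.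
Unshelve. all: by end_near.
Qed.


(** The vector field: motion towards the origin at the speed [g `|y|]. *)
Definition decay y : R := - (g `|y| * Num.sg y).

Lemma speed_ge0 y : 0 <= y -> 0 <= g y.
Proof. by move=> y0; rewrite -g_0; exact: g_nd. Qed.

Lemma decay_ge0E y : 0 <= y -> decay y = - g y.
Proof.
rewrite /decay le_eqVlt => /predU1P[<-|y0].
  by rewrite normr0 g_0 mul0r.
by rewrite gtr0_norm// gtr0_sg// mulr1.
Qed.

Lemma decay_le0E y : y <= 0 -> decay y = g (- y).
Proof.
rewrite /decay le_eqVlt => /predU1P[->|y0].
  by rewrite normr0 oppr0 g_0 mul0r oppr0.
by rewrite ltr0_norm// ltr0_sg// mulrN1 opprK.
Qed.

Lemma decay_nincr : {homo decay : y z /~ y <= z}.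
Proof.
move=> z y yz; have [y0|/ltW y0] := leP 0 y.
  by rewrite !decay_ge0E ?(le_trans y0 yz)// lerN2 g_nd.
have [z0|/ltW z0] := leP 0 z.
  rewrite decay_ge0E// decay_le0E// (@le_trans _ _ 0) ?speed_ge0 ?oppr_ge0//.
  by rewrite oppr_le0 speed_ge0.
by rewrite !decay_le0E// g_nd ?oppr_ge0 ?lerN2.
Qed.

Definition trajectory a t : R := Num.sg a * G (F `|a| - t).

Lemma trajectory_derive a t : 0 <= t ->
  is_derive t 1 (trajectory a) (decay (trajectory a t)).
Proof.
move=> t0.
have uF : F `|a| - t < F (`|a| + 1).
  apply: (@le_lt_trans _ _ (F `|a|)); first by rewrite gerBl.
  by rewrite travel_time_incr// ltrDl.
have dG := arrival_derive (`|a| + 1) (F `|a| - t) (addr_ge0 (normr_ge0 a) ler01) uF.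
have dS : is_derive t 1 (fun s => F `|a| - s) (- 1).
  by apply: is_derive_eq; rewrite add0r mul1r.
have dGS := @is_derive1_comp _ G (fun s => F `|a| - s) _ _ _ dG dS.
have -> : decay (trajectory a t) = Num.sg a * (g (G (F `|a| - t)) * - 1).
  rewrite /trajectory; set v := G _; have v0 : 0 <= v by exact: arrival_ge0.
  case: (ltgtP a 0) => [a0|a0|->].
  - by rewrite ltr0_sg// mulN1r decay_le0E ?oppr_le0// opprK; ring.
  - by rewrite gtr0_sg// mul1r decay_ge0E//; ring.
  - by rewrite sgr0 !mul0r decay_ge0E// g_0 oppr0.
have -> : trajectory a = (fun s => Num.sg a * (G \o (fun s => F `|a| - s)) s) by [].
by apply: is_derive_eq; rewrite /GRing.scale/=; ring.
Qed.

Lemma trajectory0 a : trajectory a 0 = a.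
Proof. by rewrite /trajectory subr0 travel_timeK ?normr_ge0// mulr_sg_norm. Qed.

Lemma trajectory_solution a b : (0 < b)%E -> solution decay a b (trajectory a).
Proof.
move=> b0; split => //; first exact: trajectory0.
move=> t [t0 _]; have /is_derive1_quotientP := trajectory_derive a t t0.
exact: cvg_within_filter.
Qed.

Lemma trajectory_maximal a : maximal_solution decay a +oo%E (trajectory a).
Proof.
split; first exact: trajectory_solution.
by move=> [c [y []]]; rewrite ltNge leey.
Qed.

(** A solution agrees with [trajectory], which extends it to all nonnegative times;
    so a maximal solution cannot stop at a finite time. *)
Lemma maximal_solution_trajectory a b x : maximal_solution decay a b x ->
  b = +oo%E /\ forall t, 0 <= t -> x t = trajectory a t.
Proof.
move=> [sx nx]; have b0 : (0 < b)%E by case: sx.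
have xE := solution_unique _ _ _ _ _ decay_nincr sx (trajectory_solution a b b0).
have boo : b = +oo%E.
  apply/eqP; rewrite eq_le leey leNgt; apply/negP => bly; apply: nx.
  exists +oo%E, (trajectory a); split => //; first exact: trajectory_solution.
  by move=> t Dt; rewrite xE.
by split=> // t t0; apply: xE; rewrite boo; split => //; exact: ltry.
Qed.

Lemma trajectory_norm_le a t : 0 <= t -> `|trajectory a t| <= `|a|.
Proof.
move=> t0; rewrite normrM (ger0_norm (arrival_ge0 _)).
apply: (@le_trans _ _ (G (F `|a| - t))).
  by rewrite ler_piMl ?arrival_ge0// normr_sg lern1 leq_b1.
have [u0|u0] := leP (F `|a| - t) 0; first by rewrite arrival_le0.
have [|/andP[]//] := arrivalP `|a| (F `|a| - t) (normr_ge0 a).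
by rewrite ltW//= gerBl.
Qed.

Lemma trajectory_eq0 a t : 0 <= t -> (trajectory a t == 0) = (F `|a| <= t).
Proof.
move=> t0; apply/idP/idP => [|Ft]; last first.
  by rewrite /trajectory arrival_le0 ?mulr0// subr_le0.
rewrite mulf_eq0 sgr_eq0 => /orP[/eqP->|/eqP Gu].
  by rewrite normr0 travel_time0.
rewrite leNgt; apply/negP => tF.
have [|_] := arrivalP `|a| (F `|a| - t) (normr_ge0 a).
  by rewrite subr_ge0 ltW//= gerBl.
by rewrite Gu travel_time0 => /esym/eqP; rewrite subr_eq0 gt_eqF.
Qed.

Lemma vanishes_afterE a t : vanishes_after decay a t <-> F `|a| <= t.
Proof.
split=> [[t0 /(_ _ _ (trajectory_maximal a))[_ /(_ t (lexx t))/eqP]]|Ft].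
  by rewrite trajectory_eq0.
have t0 : 0 <= t by rewrite (le_trans (travel_time_ge0 `|a|)).
split => // b x /maximal_solution_trajectory[-> xE]; split => // s ts.
have s0 : 0 <= s by exact: le_trans ts.
by apply/eqP; rewrite xE// trajectory_eq0// (le_trans Ft).
Qed.

Lemma settling_timeE a : settling_time decay a = (F `|a|)%:E.
Proof.
apply/eqP; rewrite eq_le; apply/andP; split.
  apply: ge_ereal_inf; exists (F `|a|)%:E => //.
  by exists (F `|a|) => //; exact/vanishes_afterE.
by apply/ereal_infP => _ [t /vanishes_afterE Ft <-]; rewrite lee_fin.
Qed.

Lemma decay_lyapunov_stable : lyapunov_stable decay.
Proof.
move=> e e0; exists e => // a ae b x /maximal_solution_trajectory[-> xE].
split => // t t0.
by rewrite xE// (le_lt_trans (trajectory_norm_le _ _ t0)).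
Qed.

Lemma travel_timeE y : (F y)%:E = (\int[mu]_(z in `[0%R, y]) (g z)^-1%:E)%E.
Proof.
rewrite /travel_time /parameterized_integral /Rintegral fineK//.
by apply: integrable_fin_num => //; exact: integrable_slowness.
Qed.

Lemma slowness_ge0 z : 0 <= z -> 0 <= (g z)^-1.
Proof. by move=> z0; rewrite invr_ge0 speed_ge0. Qed.

Lemma travel_time_le_integral y :
  ((F y)%:E <= \int[mu]_(z in `[0%R, +oo[) (g z)^-1%:E)%E.
Proof.
rewrite travel_timeE; apply: ge0_subset_integral => //.
- by have /measurable_int := g_int.
- by move=> z; rewrite /= in_itv/= andbT => z0; rewrite lee_fin slowness_ge0.
- exact: subset_itvl.
Qed.

(** The settling times of the initial conditions [n + 1] already tend to the whole
    integral, by monotone convergence. *)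
Lemma ereal_sup_settling_time :
  ereal_sup [set settling_time decay a | a in [set: R]] =
  (\int[mu]_(y in `[0%R, +oo[) (g y)^-1%:E)%E.
Proof.
apply/eqP; rewrite eq_le; apply/andP; split.
  by apply/ereal_supP => _ [a _ <-]; rewrite settling_timeE travel_time_le_integral.
rewrite itv0y_bigcup0S.
have : (\int[mu]_(y in `[0%R, n.+1%:R]) (g y)^-1%:E)%E @[n --> \oo] -->
    (\int[mu]_(y in \bigcup_n `[0%R, n.+1%:R]%classic) (g y)^-1%:E)%E.
  apply: ge0_nondecreasing_set_cvg_integral => //.
  - by move=> m n mn; rewrite subsetEset; apply: subset_itvl; rewrite bnd_simp ler_nat.
  - by move=> n; have /measurable_int := integrable_slowness n.+1%:R.
  - by move=> n z; rewrite /= in_itv/= => /andP[z0 _]; rewrite lee_fin slowness_ge0.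
move=> cF; rewrite -(cvg_lim _ cF)//; apply: lime_le; first exact: cvgP cF.
near=> n; rewrite -travel_timeE; apply: le_ereal_sup_tmp.
exists (settling_time decay n.+1%:R) => //.
by rewrite settling_timeE ger0_norm.
Unshelve. all: by end_near.
Qed.

Lemma decay_fixed_time_stable : fixed_time_stable decay.
Proof.
split; first split; first exact: decay_lyapunov_stable.
  move=> a; split; first by exists +oo%E, (trajectory a); exact: trajectory_maximal.
  by exists (F `|a|); exact/vanishes_afterE.
have Ifin : (\int[mu]_(y in `[0%R, +oo[) (g y)^-1%:E)%E \is a fin_num.
  exact: integrable_fin_num.
set I := (\int[mu]_(y in `[0%R, +oo[) (g y)^-1%:E)%E in Ifin *.
have I0 : 0 <= fine I.
  by rewrite fine_ge0// (le_trans _ (travel_time_le_integral 0))// travel_time0.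
exists (fine I + 1); first by rewrite ltr_wpDl.
move=> a; rewrite settling_timeE lee_fin (@le_trans _ _ (fine I)) ?lerDl//.
by have := travel_time_le_integral `|a|; rewrite -/I -(fineK Ifin) lee_fin.
Qed.

End ScalarFlow.

(** * The speed given by a sum of two powers *)

Section PowerSumSpeed.
Context {R : realType} (alpha beta p q k : R).
Context (halpha : 0 < alpha) (hbeta : 0 < beta) (hp : 0 < p) (hq : 0 < q) (hk : 0 < k).

Let s (y : R) := alpha * y `^ p + beta * y `^ q.
Definition power_sum_speed (y : R) : R := (alpha * y `^ p + beta * y `^ q) `^ k.

Let s_gt0 y : 0 < y -> 0 < s y.
Proof. by move=> y0; rewrite addr_gt0// mulr_gt0// powR_gt0. Qed.

Let s_ge0 y : 0 <= s y.
Proof. by rewrite addr_ge0// mulr_ge0 ?powR_ge0// ltW. Qed.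

Lemma power_sum_speed0 : power_sum_speed 0 = 0.
Proof. by rewrite /power_sum_speed !powR0 ?gt_eqF// !mulr0 addr0 powR0 ?gt_eqF. Qed.

Lemma power_sum_speed_gt0 y : 0 < y -> 0 < power_sum_speed y.
Proof. by move=> y0; exact/powR_gt0/s_gt0. Qed.

Lemma power_sum_speed_nd y z : 0 <= y -> y <= z -> power_sum_speed y <= power_sum_speed z.
Proof.
move=> y0 yz; have z0 := le_trans y0 yz.
apply: ge0_ler_powR; rewrite ?nnegrE ?s_ge0// ?(ltW hk)//.
by apply: lerD; rewrite ler_pM2l// ge0_ler_powR ?nnegrE// ltW.
Qed.

Lemma power_sum_speed_continuous y : 0 < y -> {for y, continuous power_sum_speed}.
Proof.
move=> y0; apply: (@continuous_comp _ _ _ s (fun z => z `^ k)).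
  by apply: continuousD; exact: powR_monomial_continuous.
by apply: powR_continuous; exact: s_gt0.
Qed.

Lemma power_sum_speed_cvg0 : power_sum_speed y @[y --> 0^'+] --> 0.
Proof.
have s0 : s y @[y --> 0^'+] --> 0.
  have : s y @[y --> 0^'+] --> alpha * 0 + beta * 0; last by rewrite !mulr0 addr0.
  by apply: cvgD; apply: cvgMl_tmp; exact: powR_cvg0.
have sr : s y @[y --> 0^'+] --> 0^'+.
  move=> A nA; have y0 : \forall y \near 0^'+, 0 < y :> R by exact: nbhs_right_gt.
  have nA' : \forall y \near 0^'+, 0 < s y -> A (s y) by exact: (s0 _ nA).
  by apply: filterS2 nA' y0 => y sA /s_gt0; exact: sA.
exact: cvg_comp sr (powR_cvg0 hk).
Qed.

Lemma power_sum_speed_measurable (D : set R) :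
  measurable_fun D (fun y => (power_sum_speed y)^-1%:E).
Proof.
apply/measurable_EFinP; apply: measurable_funTS; under eq_fun do rewrite -powRN.
apply: (@measurableT_comp _ _ _ _ _ _ (fun y : R => y `^ (- k))).
  exact: measurable_powR.
by apply: measurable_funD; apply: measurable_funM.
Qed.

End PowerSumSpeed.


Theorem theorem1 (R : realType) (alpha beta p q k : R)
    (halpha : 0 < alpha) (hbeta : 0 < beta) (hp : 0 < p) (hq : 0 < q)
    (hk : 0 < k) (hkp : k * p < 1) (hkq : 1 < k * q) :
  let mp := (1 - k * p) / (q - p) in
  let mq := (k * q - 1) / (q - p) in
  let gamma := Gamma mp * Gamma mq / (alpha `^ k * Gamma k * (q - p))
               * (alpha / beta) `^ mp in
  let f := fun x : R =>
    - ((alpha * `|x| `^ p + beta * `|x| `^ q) `^ k * Num.sg x) in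
  fixed_time_stable f /\
  ereal_sup [set settling_time f x0 | x0 in [set: R]] = gamma%:E.

move=> mp mq gamma f.
pose g := power_sum_speed alpha beta p q k.
have g_integral : (\int[lebesgue_measure]_(y in `[0%R, +oo[) (g y)^-1%:E = gamma%:E)%E.
  rewrite -integral_itv_obnd_cbnd; last exact: power_sum_speed_measurable.
  exact: integral_inv_power_sum.
have g_int : lebesgue_measure.-integrable `[0, +oo[ (fun y => (g y)^-1%:E).
  apply/integrableP; split; first exact: power_sum_speed_measurable.
  under eq_integral do rewrite gee0_abs ?lee_fin ?invr_ge0 ?powR_ge0//.
  by rewrite g_integral ltry.
rewrite -g_integral; split.
  apply: (@decay_fixed_time_stable _ g) g_int.
- exact: power_sum_speed0.
- exact: power_sum_speed_gt0.
- exact: power_sum_speed_nd.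
- exact: power_sum_speed_continuous.
- exact: power_sum_speed_cvg0.
apply: (@ereal_sup_settling_time _ g) g_int.
- exact: power_sum_speed0.
- exact: power_sum_speed_gt0.
- exact: power_sum_speed_nd.
- exact: power_sum_speed_continuous.
- exact: power_sum_speed_cvg0.
Qed.
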